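(* Let $n$ be a positive integer, and let $v:S(\mathbb{C}^n)\to\mathbb{C}^n-\{0\}$ and $w:S(\mathbb{H}^n)\to\mathbb{H}^n-\{0\}$ be continuous functions. Then: (i) $v$ is a complex vector field on $S(\mathbb{C}^n)$ if and only if $r_{\mathbb C}\circ v\circ r_{\mathbb C}^{-1}$ and $r_{\mathbb C}\circ\alpha_i\circ v\circ r_{\mathbb C}^{-1}$ are real vector fields on $S(\mathbb{R}^{2n})$. (ii) $w$ is a quaternionic vector field on $S(\mathbb{H}^n)$ if and only if $c_{\mathbb H}\circ w\circ c_{\mathbb H}^{-1}$ and $c_{\mathbb H}\circ\alpha_j\circ w\circ c_{\mathbb H}^{-1}$ are complex vector fields on $S(\mathbb{C}^{2n})$. (iii) $w$ is a quaternionic vector field on $S(\mathbb{H}^n)$ if and only if $r_{\mathbb H}\circ w\circ r_{\mathbb H}^{-1}$ and $r_{\mathbb H}\circ\alpha_t\circ w\circ r_{\mathbb H}^{-1}$ for all $t\in\{i,j,k\}$ are real vector fields on $S(\mathbb{R}^{4n})$.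
   Context: $\mathbb{F}$ denotes one of $\mathbb{R}$, $\mathbb{C}$, $\mathbb{H}$ with usual conjugation. $\mathbb{F}^n$ is a right inner product space over $\mathbb{F}$ with $\langle(x_1,\ldots,x_n)|(y_1,\ldots,y_n)\rangle_{\mathbb F}=\sum_{m=1}^n\bar{x}_m y_m$, and $S(\mathbb{F}^n)=\{x\in\mathbb{F}^n:\langle x|x\rangle_{\mathbb F}=1\}$. An $\mathbb{F}$-vector field on $S(\mathbb{F}^n)$ (real, complex, quaternionic for $\mathbb{F}=\mathbb{R},\mathbb{C},\mathbb{H}$) is a continuous function $v:S(\mathbb{F}^n)\to\mathbb{F}^n-\{0\}$ with $\langle x|v(x)\rangle_{\mathbb F}=0$ for every $x\in S(\mathbb{F}^n)$. The realification $r_{\mathbb C}:\mathbb{C}^n\to\mathbb{R}^{2n}$ is $r_{\mathbb C}(a_1+b_1i,\ldots,a_n+b_ni)=(a_1,b_1,\ldots,a_n,b_n)$. The complexification $c_{\mathbb H}:\mathbb{H}^n\to\mathbb{C}^{2n}$ is $c_{\mathbb H}(a_1+b_1i+c_1j+d_1k,\ldots,a_n+b_ni+c_nj+d_nk)=(a_1+b_1i,\,d_1+c_1i,\ldots,a_n+b_ni,\,d_n+c_ni)$. The realification $r_{\mathbb H}:\mathbb{H}^n\to\mathbb{R}^{4n}$ is $r_{\mathbb H}=r_{\mathbb C}\circ c_{\mathbb H}$. These are norm-preserving bijections, so they and their inverses restrict to the unit spheres. For $t\in\mathbb{F}$, $\alpha_t:\mathbb{F}^n\to\mathbb{F}^n$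 is right multiplication, $\alpha_t(x)=x\cdot t$. *)

(* Defs.v *)
From HB Require Import structures.
From mathcomp Require Import all_boot all_order all_algebra.
From mathcomp Require Import all_classical all_reals all_analysis.
From mathcomp Require Import complex ring.
Import Order.TTheory GRing.Theory Num.Theory.
Import numFieldNormedType.Exports.
Set Implicit Arguments.
Unset Strict Implicit.
Unset Printing Implicit Defensive.
Local Open Scope classical_set_scope.
Local Open Scope ring_scope.

(* R, C and H are treated uniformly as topological types carrying a possibly
   noncommutative ring structure and a conjugation; no compatibility between
   the topology and the algebra is needed for the definitions. *)
HB.mixin Record hasConj F & GRing.PzRing F := {
  sconj : F -> F;
  sconjK : involutive sconj;
  sconj1 : sconj 1 = 1;
  sconjD : {morph sconj : x y / x + y};
  sconjM : forall x y, sconj (x * y) = sconj y * sconj x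
}.

#[short(type="topStarRingType")]
HB.structure Definition TopStarRing :=
  {F of GRing.PzRing F & Topological F & hasConj F}.

#[non_forgetful_inheritance]
HB.instance Definition _ (R : realType) := @hasConj.Build R idfun
  (fun=> erefl) erefl (fun _ _ => erefl) (@mulrC R).

HB.instance Definition _ (R : realType) := PseudoPointedMetric.copy R[i] R[i]^o.

HB.instance Definition _ (R : realType) := @hasConj.Build R[i] (@conjc R)
  (@conjcK R) (rmorph1 _) (rmorphD _)
  (fun x y => etrans (rmorphM (@conjc R) x y) (mulrC _ _)).

(* [Quaternion a b c d] is a + bi + cj + dk. *)
Record quaternion (R : Type) := Quaternion { qre : R; qii : R; qjj : R; qkk : R }.

Section Quaternions.
Variable R : realType.
Local Notation H := (quaternion R).

Definition coords_of_quaternion (q : H) : R * R * R * R :=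
  (qre q, qii q, qjj q, qkk q).
Definition quaternion_of_coords (p : R * R * R * R) : H :=
  let: (a, b, c, d) := p in Quaternion a b c d.

Lemma coords_of_quaternionK : cancel coords_of_quaternion quaternion_of_coords.
Proof. by case. Qed.

HB.instance Definition _ := Choice.copy H (can_type coords_of_quaternionK).

Definition addq (x y : H) : H :=
  Quaternion (qre x + qre y) (qii x + qii y) (qjj x + qjj y) (qkk x + qkk y).
Definition oppq (x : H) : H :=
  Quaternion (- qre x) (- qii x) (- qjj x) (- qkk x).

Lemma addqA : associative addq.
Proof. by move=> x y z; rewrite /addq /= !addrA. Qed.
Lemma addqC : commutative addq.
Proof. by move=> x y; congr Quaternion; rewrite addrC. Qed.
Lemma add0q : left_id (Quaternion 0 0 0 0) addq.
Proof. by case=> *; rewrite /addq /= !add0r. Qed.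
Lemma addNq : left_inverse (Quaternion 0 0 0 0) oppq addq.
Proof. by case=> *; rewrite /addq /= !addNr. Qed.

HB.instance Definition _ := GRing.isZmodule.Build H addqA addqC add0q addNq.

Definition mulq (x y : H) : H :=
  let: Quaternion a b c d := x in let: Quaternion a' b' c' d' := y in
  Quaternion (a * a' - b * b' - c * c' - d * d')
             (a * b' + b * a' + c * d' - d * c')
             (a * c' - b * d' + c * a' + d * b')
             (a * d' + b * c' - c * b' + d * a').

Lemma mulqA : associative mulq.
Proof. by case=> ? ? ? ? [? ? ? ?] [? ? ? ?]; congr Quaternion; ring. Qed.
Lemma mul1q : left_id (Quaternion 1 0 0 0) mulq.
Proof. by case=> *; congr Quaternion; ring. Qed.
Lemma mulq1 : right_id (Quaternion 1 0 0 0) mulq.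
Proof. by case=> *; congr Quaternion; ring. Qed.
Lemma mulqDl : left_distributive mulq addq.
Proof. by case=> ? ? ? ? [? ? ? ?] [? ? ? ?]; congr Quaternion => /=; ring. Qed.
Lemma mulqDr : right_distributive mulq addq.
Proof. by case=> ? ? ? ? [? ? ? ?] [? ? ? ?]; congr Quaternion => /=; ring. Qed.
Lemma oneq_neq0 : Quaternion 1 0 0 0 != 0 :> H.
Proof. by apply/eqP => -[/eqP]; rewrite oner_eq0. Qed.

HB.instance Definition _ :=
  GRing.Zmodule_isNzRing.Build H mulqA mul1q mulq1 mulqDl mulqDr oneq_neq0.

(* The Euclidean topology of R^4. *)
HB.instance Definition _ :=
  Topological.copy H (initial_topology coords_of_quaternion).

Definition conjq (x : H) : H := Quaternion (qre x) (- qii x) (- qjj x) (- qkk x).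

Lemma conjqK : involutive conjq.
Proof. by case=> *; rewrite /conjq /= !opprK. Qed.
Lemma conjq1 : conjq 1 = 1.
Proof. by rewrite /conjq /= oppr0. Qed.
Lemma conjqD : {morph conjq : x y / x + y}.
Proof. by move=> x y; rewrite /conjq /= !opprD. Qed.
Lemma conjqM x y : conjq (x * y) = conjq y * conjq x.
Proof. by case: x y => ? ? ? ? [? ? ? ?]; congr Quaternion => /=; ring. Qed.

HB.instance Definition _ := hasConj.Build H conjqK conjq1 conjqD conjqM.

Definition quat_i : H := Quaternion 0 1 0 0.
Definition quat_j : H := Quaternion 0 0 1 0.
Definition quat_k : H := Quaternion 0 0 0 1.

End Quaternions.
Arguments quat_i {R}.
Arguments quat_j {R}.
Arguments quat_k {R}.

Section VectorFields.
Variables (F : topStarRingType) (n : nat).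
Implicit Types (x y : 'rV[F]_n) (v : 'rV[F]_n -> 'rV[F]_n).

Definition inner x y : F := \sum_(m < n) sconj (x 0 m) * y 0 m.

Definition usphere : set 'rV[F]_n := [set x | inner x x = 1].

(* A continuous function from the sphere to F^n - {0} is represented by a total
   function, of which only the restriction to the sphere is constrained. *)
Definition continuous_nonzero v : Prop :=
  {within usphere, continuous v} /\ forall x, usphere x -> v x != 0.

Definition vector_field v : Prop :=
  continuous_nonzero v /\ forall x, usphere x -> inner x (v x) = 0.

Definition alpha (t : F) x : 'rV[F]_n := \row_m (x 0 m * t).

End VectorFields.

Section Interleave.
Variables (T : Type) (n : nat).

Lemma half_ord_subproof (k : 'I_(2 * n)) : (k./2 < n)%N.
Proof. by rewrite ltn_half_double -mul2n. Qed.
Lemma even_ord_subproof (m : 'I_n) : (2 * m < 2 * n)%N.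
Proof. by rewrite ltn_mul2l ltn_ord. Qed.
Lemma odd_ord_subproof (m : 'I_n) : ((2 * m).+1 < 2 * n)%N.
Proof. by rewrite !mul2n -doubleS ltn_Sdouble. Qed.

Definition half_ord (k : 'I_(2 * n)) : 'I_n := Ordinal (half_ord_subproof k).
Definition even_ord (m : 'I_n) : 'I_(2 * n) := Ordinal (even_ord_subproof m).
Definition odd_ord (m : 'I_n) : 'I_(2 * n) := Ordinal (odd_ord_subproof m).

(* (a_1, ..., a_n), (b_1, ..., b_n) |-> (a_1, b_1, ..., a_n, b_n) *)
Definition interleave (a b : 'rV[T]_n) : 'rV[T]_(2 * n) :=
  \row_k (if odd k then b else a) 0 (half_ord k).
Definition evens (y : 'rV[T]_(2 * n)) : 'rV[T]_n := \row_m y 0 (even_ord m).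
Definition odds (y : 'rV[T]_(2 * n)) : 'rV[T]_n := \row_m y 0 (odd_ord m).

Lemma interleaveKl a b : evens (interleave a b) = a.
Proof.
apply/rowP => m; rewrite !mxE /= mul2n odd_double.
by congr (a 0 _); apply/val_inj; rewrite /= mul2n doubleK.
Qed.

Lemma interleaveKr a b : odds (interleave a b) = b.
Proof.
apply/rowP => m; rewrite !mxE /= mul2n odd_double /=.
by congr (b 0 _); apply/val_inj; rewrite /= mul2n uphalf_double.
Qed.

Lemma evens_oddsK y : interleave (evens y) (odds y) = y.
Proof.
apply/rowP => k; rewrite !mxE; case: ifP => ok; rewrite mxE; congr (y 0 _);
  apply/val_inj; rewrite /= mul2n -[RHS]odd_double_half ok //.
Qed.

End Interleave.

Section Realification.
Variables (R : realType) (n : nat).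
Local Notation C := R[i].
Local Notation H := (quaternion R).

Definition rC (x : 'rV[C]_n) : 'rV[R]_(2 * n) :=
  interleave (\row_m complex.Re (x 0 m)) (\row_m complex.Im (x 0 m)).
Definition rC_inv (y : 'rV[R]_(2 * n)) : 'rV[C]_n :=
  \row_m (evens y 0 m +i* odds y 0 m)%C.

Lemma rCK : cancel rC rC_inv.
Proof.
move=> x; apply/rowP => m; rewrite mxE interleaveKl interleaveKr !mxE.
by case: (x 0 m).
Qed.

Lemma rC_invK : cancel rC_inv rC.
Proof.
move=> y; rewrite -[RHS]evens_oddsK /rC.
by congr interleave; apply/rowP => m; rewrite !mxE.
Qed.

Definition cH (x : 'rV[H]_n) : 'rV[C]_(2 * n) :=
  interleave (\row_m (qre (x 0 m) +i* qii (x 0 m))%C)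
             (\row_m (qkk (x 0 m) +i* qjj (x 0 m))%C).
Definition cH_inv (y : 'rV[C]_(2 * n)) : 'rV[H]_n :=
  \row_m Quaternion (complex.Re (evens y 0 m)) (complex.Im (evens y 0 m))
                    (complex.Im (odds y 0 m)) (complex.Re (odds y 0 m)).

Lemma cHK : cancel cH cH_inv.
Proof.
move=> x; apply/rowP => m; rewrite mxE interleaveKl interleaveKr !mxE.
by case: (x 0 m).
Qed.

Lemma cH_invK : cancel cH_inv cH.
Proof.
move=> y; rewrite -[RHS]evens_oddsK /cH.
by congr interleave; apply/rowP => m; rewrite !mxE /=; case: (y 0 _).
Qed.

End Realification.

(* r_C after c_H lands in R^(2 * (2 * n)); the casts identify it with
   R^(4 * n), using that 2 * 2 reduces to 4. *)
Definition rH (R : realType) (n : nat) (x : 'rV[quaternion R]_n) :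
  'rV[R]_(4 * n) := castmx (erefl 1%N, mulnA 2 2 n) (rC (cH x)).
Definition rH_inv (R : realType) (n : nat) (y : 'rV[R]_(4 * n)) :
  'rV[quaternion R]_n :=
  cH_inv (rC_inv (castmx (erefl 1%N, esym (mulnA 2 2 n)) y)).

Lemma rHK (R : realType) (n : nat) : cancel (@rH R n) (@rH_inv R n).
Proof. by move=> x; rewrite /rH_inv (castmxK (erefl 1%N) (mulnA 2 2 n)) rCK cHK. Qed.

Lemma rH_invK (R : realType) (n : nat) : cancel (@rH_inv R n) (@rH R n).
Proof. by move=> y; rewrite /rH cH_invK rC_invK (castmxKV (erefl 1%N) (mulnA 2 2 n)). Qed.

Arguments rC {R n}.
Arguments rC_inv {R n}.
Arguments cH {R n}.
Arguments cH_inv {R n}.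
Arguments rH {R n}.
Arguments rH_inv {R n}.

(* Main.v *)
(* Each of the maps f = r_C, c_H, r_H is a homeomorphism carrying the inner
   product to a real-linear part of it: <f x|f y> = pr <x|y>, where pr keeps the
   real part of a complex number, the complex part a + bi of a quaternion, and
   the real part of a quaternion, respectively. As <x|y t> = <x|y> t, the field
   f o alpha_t o v o f^-1 is orthogonal to the position vector exactly when
   pr (<x|v x> t) = 0, and letting t range over 1 and the given units recovers
   every coordinate of <x|v x> up to sign. *)
Require Import Defs.
From HB Require Import structures.
From mathcomp Require Import all_boot all_order all_algebra.
From mathcomp Require Import all_classical all_reals all_analysis.
From mathcomp Require Import complex ring.
Import Order.TTheory GRing.Theory Num.Theory.
Import numFieldNormedType.Exports.
Local Open Scope classical_set_scope.
Local Open Scope ring_scope.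

(** * Continuity into and out of matrices, entry by entry *)

Lemma mx_entry_continuous {T : topologicalType} {m n : nat} (i : 'I_m)
  (j : 'I_n) : continuous (fun M : 'M[T]_(m, n) => M i j).
Proof.
(* The box constrains only the entry [(i, j)], by [A]; the implications make every other side the
   whole space. *)
move=> M A MA; exists (fun i' j' => [set x | i' = i -> j' = j -> A x]).
  move=> i' j'; case: (eqVneq i' i) => [->|/eqP ne]; last first.
    by apply: filterS (filterT : nbhs _ setT) => x _ /ne.
  case: (eqVneq j' j) => [->|/eqP ne]; first by apply: filterS MA => x Ax _ _.
  by apply: filterS (filterT : nbhs _ setT) => x _ _ /ne.
by move=> N /(_ i j) /=; exact.
Qed.

(** A basic neighbourhood of a matrix is a box with one neighbourhood per entry, and finitely many
    conditions that hold near a point hold there jointly. *)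
Lemma continuous_mx {S T : topologicalType} {m n : nat}
    (f : S -> 'M[T]_(m, n)) :
  (forall i j, continuous (fun x => f x i j)) -> continuous f.
Proof.
move=> fc x A [P xP PA].
have : \forall y \near x, forall i j, P i j (f y i j).
  apply: filter_forall => i; apply: filter_forall => j.
  exact: fc (xP i j).
by apply: filterS => y; exact: PA.
Qed.

(** * Complex numbers and their real coordinates *)

Lemma continuous_complex_part {R : realType} (p : R[i] -> R) :
  (forall z w, p z - p w = p (z - w)) -> (forall z, `|p z|%:C%C <= `|z|) ->
  continuous p.
Proof.
move=> pB ple z A /nbhs_ballP[e /= e0 eA].
(* By the two hypotheses [p] is 1-Lipschitz, so the same radius works. The norm of [R[i]] takes
   values in [R[i]], hence the embedding of [e]. *)
exists e%:C%C; first by rewrite /= ltcR.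
move=> w /= zw; apply: eA; rewrite /ball /= pB -ltcR.
exact: le_lt_trans (ple _) zw.
Qed.

Lemma ReC_continuous {R : realType} :
  continuous (@complex.Re R : R[i] -> R).
Proof. by apply: continuous_complex_part (@normc_ge_Re R) => -[? ?] []. Qed.

Lemma ImC_continuous {R : realType} :
  continuous (@complex.Im R : R[i] -> R).
Proof.
apply: continuous_complex_part => [[? ?] []//|z].
by rewrite normc_def lecR -sqrtr_sqr ler_wsqrtr// lerDr sqr_ge0.
Qed.

Lemma normc_leD {R : realType} (a b : R) :
  `|(a +i* b)%C| <= (`|a| + `|b|)%:C%C.
Proof.
rewrite normc_def lecR /=.
have ab0 : 0 <= `|a| + `|b| by exact: addr_ge0.
rewrite -[leRHS](ger0_norm ab0) -sqrtr_sqr ler_wsqrtr//.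
by rewrite sqrrD !real_normK ?num_real// lerD2r lerDl mulrn_wge0 ?mulr_ge0.
Qed.

Lemma continuous_complex {T : topologicalType} {R : realType} (f g : T -> R) :
  continuous f -> continuous g -> continuous (fun x => (f x +i* g x)%C).
Proof.
move=> fc gc x A [[e e'] /= ee' eA].
(* A radius in [R[i]] is a complex number; positivity in the order of [R[i]] forces its imaginary
   part to vanish. *)
have [e0 e'0] : 0 < e /\ e' = 0.
  by move: ee'; rewrite /= ltcE /= => /andP[/eqP-> ->].
rewrite {}e'0 {e' ee'} in eA.
have e20 : 0 < e / 2 by rewrite divr_gt0.
have fe : \forall y \near x, `|f x - f y| < e / 2.
  by have /cvgrPdist_lt := fc x; apply.
have ge : \forall y \near x, `|g x - g y| < e / 2.
  by have /cvgrPdist_lt := gc x; apply.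
suff : \forall y \near x, A (f y +i* g y)%C by [].
near=> y; apply: eA; rewrite /ball_ /=.
apply: le_lt_trans (normc_leD _ _) _; rewrite ltcR [e]splitr.
by apply: ltrD; near: y.
Unshelve. all: by end_near. Qed.

(** * Composites, pairs, and the coordinates of quaternions *)

Lemma continuousT_comp {S T U : topologicalType} {f : S -> T} {g : T -> U} :
  continuous f -> continuous g -> continuous (g \o f).
Proof. by move=> fc gc x; apply: continuous_comp; [exact: fc|exact: gc]. Qed.

Lemma fst_continuous {S T : topologicalType} : continuous (@fst S T).
Proof. by move=> [x y]; exact: cvg_fst. Qed.

Lemma snd_continuous {S T : topologicalType} : continuous (@snd S T).
Proof. by move=> [x y]; exact: cvg_snd. Qed.

Lemma continuous_pair {S T U : topologicalType} {f : S -> T} {g : S -> U} :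
  continuous f -> continuous g -> continuous (fun x => (f x, g x)).
Proof. by move=> fc gc x; apply: cvg_pair; [exact: fc|exact: gc]. Qed.

Lemma quaternion_coord_continuous {R : realType} (p : R * R * R * R -> R) :
  continuous p -> continuous (p \o @coords_of_quaternion R).
Proof.
apply: continuousT_comp.
exact: initial_continuous.
Qed.

Lemma qre_continuous {R : realType} : continuous (@qre R).
Proof.
apply: (@quaternion_coord_continuous _ ((fst \o fst) \o fst)).
by do 2![apply: continuousT_comp; first exact: fst_continuous];
  exact: fst_continuous.
Qed.

Lemma qii_continuous {R : realType} : continuous (@qii R).
Proof.
apply: (@quaternion_coord_continuous _ ((snd \o fst) \o fst)).
by do 2![apply: continuousT_comp; first exact: fst_continuous];
  exact: snd_continuous.
Qed.

Lemma qjj_continuous {R : realType} : continuous (@qjj R).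
Proof.
apply: (@quaternion_coord_continuous _ (snd \o fst)).
exact: continuousT_comp fst_continuous snd_continuous.
Qed.

Lemma qkk_continuous {R : realType} : continuous (@qkk R).
Proof. exact: (quaternion_coord_continuous _ snd_continuous). Qed.

(** By the universal property of the initial topology, it is enough that the tuple of coordinates is
    continuous. *)
Lemma continuous_quaternion {T : topologicalType} {R : realType}
    (f g h k : T -> R) :
  continuous f -> continuous g -> continuous h -> continuous k ->
  continuous (fun x => Quaternion (f x) (g x) (h x) (k x)).
Proof.
move=> fc gc hc kc.
apply: (@continuous_comp_initial _ _ _ (@coords_of_quaternion R)).
have fgc := continuous_pair fc gc.
exact: (continuous_pair (continuous_pair fgc hc) kc).
Qed.

(** * Continuity of $r_C$, $c_H$, $r_H$ and of their inverses *)

Lemma continuous_entry {S T : topologicalType} {m n : nat}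
    {f : S -> 'M[T]_(m, n)} (i : 'I_m) (j : 'I_n) :
  continuous f -> continuous (fun x => f x i j).
Proof. move=> fc; exact: (continuousT_comp fc (mx_entry_continuous i j)). Qed.

Lemma interleave_continuous {S T : topologicalType} {n : nat}
    (a b : S -> 'rV[T]_n) :
  continuous a -> continuous b -> continuous (fun x => interleave (a x) (b x)).
Proof.
move=> ac bc; apply: continuous_mx => i k.
under eq_fun do rewrite mxE.
by case: (odd k); apply: continuous_entry.
Qed.

Lemma evens_continuous {T : topologicalType} {n : nat} :
  continuous (@evens T n).
Proof.
apply: continuous_mx => i m; under eq_fun do rewrite mxE.
exact: mx_entry_continuous.
Qed.

Lemma odds_continuous {T : topologicalType} {n : nat} :
  continuous (@odds T n).
Proof.
apply: continuous_mx => i m; under eq_fun do rewrite mxE.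
exact: mx_entry_continuous.
Qed.

Lemma row_map_continuous {S T : topologicalType} {n : nat} (f : S -> T) :
  continuous f -> continuous (fun x : 'rV[S]_n => \row_m f (x 0 m)).
Proof.
move=> fc; apply: continuous_mx => i m; under eq_fun do rewrite mxE.
exact: (continuousT_comp (mx_entry_continuous 0 m) fc).
Qed.

Lemma rC_continuous {R : realType} {n : nat} : continuous (@rC R n).
Proof.
by apply: interleave_continuous; apply: row_map_continuous;
  [exact: ReC_continuous|exact: ImC_continuous].
Qed.

Lemma rC_inv_continuous {R : realType} {n : nat} : continuous (@rC_inv R n).
Proof.
apply: continuous_mx => i m; under eq_fun do rewrite mxE.
apply: continuous_complex.
- exact: (continuous_entry 0 m evens_continuous).
- exact: (continuous_entry 0 m odds_continuous).
Qed.

Lemma cH_continuous {R : realType} {n : nat} : continuous (@cH R n).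
Proof.
apply: interleave_continuous.
- apply: (row_map_continuous (fun q => (qre q +i* qii q)%C)).
  by apply: continuous_complex; [exact: qre_continuous|exact: qii_continuous].
- apply: (row_map_continuous (fun q => (qkk q +i* qjj q)%C)).
  by apply: continuous_complex; [exact: qkk_continuous|exact: qjj_continuous].
Qed.

Lemma cH_inv_continuous {R : realType} {n : nat} : continuous (@cH_inv R n).
Proof.
apply: continuous_mx => i m; under eq_fun do rewrite mxE.
have evc : continuous (fun y : 'rV[R[i]]_(2 * n) => evens y 0 m).
  exact: (continuous_entry 0 m evens_continuous).
have odc : continuous (fun y : 'rV[R[i]]_(2 * n) => odds y 0 m).
  exact: (continuous_entry 0 m odds_continuous).
apply: continuous_quaternion.
- exact: (continuousT_comp evc ReC_continuous).
- exact: (continuousT_comp evc ImC_continuous).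
- exact: (continuousT_comp odc ImC_continuous).
- exact: (continuousT_comp odc ReC_continuous).
Qed.

Lemma castmx_continuous {T : topologicalType} {m n m' n' : nat}
    (e : (m = m') * (n = n')) :
  continuous (castmx e : 'M[T]_(m, n) -> 'M[T]_(m', n')).
Proof.
apply: continuous_mx => i j; under eq_fun do rewrite castmxE.
exact: mx_entry_continuous.
Qed.

Lemma rH_continuous {R : realType} {n : nat} : continuous (@rH R n).
Proof.
apply: (@continuousT_comp _ _ _ (@rC R _ \o cH) _ _ (castmx_continuous _)).
exact: (continuousT_comp cH_continuous rC_continuous).
Qed.

Lemma rH_inv_continuous {R : realType} {n : nat} : continuous (@rH_inv R n).
Proof.
apply: (@continuousT_comp _ _ _ _ (@cH_inv R n \o rC_inv)
  (castmx_continuous _)).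
exact: (continuousT_comp rC_inv_continuous cH_inv_continuous).
Qed.

(** * Inner products under right multiplication and under the three maps *)

Lemma inner_alpha {F : topStarRingType} {n : nat} (t : F) (x y : 'rV[F]_n) :
  inner x (alpha t y) = inner x y * t.
Proof.
(* The scalar stands at the right end of every summand, so it factors out without commutativity. *)
by rewrite /inner mulr_suml; apply: eq_bigr => m _; rewrite mxE mulrA.
Qed.

Lemma alpha1 {F : topStarRingType} {n : nat} (x : 'rV[F]_n) : alpha 1 x = x.
Proof. by apply/rowP => m; rewrite mxE mulr1. Qed.

Lemma alpha_eq0 {F : topStarRingType} {n : nat} (t s : F) (x : 'rV[F]_n) :
  t * s = 1 -> alpha t x = 0 -> x = 0.
Proof.
move=> ts /rowP xt0; apply/rowP => m.
have := xt0 m; rewrite !mxE => xmt.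
by rewrite -[LHS]mulr1 -ts mulrA xmt mul0r.
Qed.

(** Halving inverts [even_ord] on the even indices and [odd_ord] on the odd ones, so both halves of
    the sum can be reindexed. *)
Lemma big_even_odd {V : nmodType} {n : nat} (F : 'I_(2 * n) -> V) :
  \sum_k F k = \sum_m F (even_ord m) + \sum_m F (odd_ord m).
Proof.
rewrite (bigID (fun k : 'I_(2 * n) => odd k)) /= addrC; congr (_ + _).
  rewrite (reindex_onto (@even_ord n) (@half_ord n)) => [|k ek].
    apply: eq_bigl => m; rewrite /= mul2n odd_double /=.
    by apply/eqP/val_inj; rewrite /= mul2n doubleK.
  by apply/val_inj; rewrite /= mul2n -[RHS]odd_double_half (negPf ek).
rewrite (reindex_onto (@odd_ord n) (@half_ord n)) => [|k ok].
  apply: eq_bigl => m; rewrite /= mul2n odd_double /=.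
  by apply/eqP/val_inj; rewrite /= mul2n uphalf_double.
by apply/val_inj; rewrite /= mul2n -[RHS]odd_double_half ok.
Qed.

(** Both $r_C$ and $c_H$ are interleavings, so this reduces their inner products to sums over
    ['I_n]. *)
Lemma inner_interleave {F : topStarRingType} {n : nat} (a b a' b' : 'rV[F]_n) :
  inner (interleave a b) (interleave a' b') = inner a a' + inner b b'.
Proof.
rewrite /inner big_even_odd.
congr (_ + _); apply: eq_bigr => m _.
  rewrite -[a in RHS](interleaveKl a b) -[a' in RHS](interleaveKl a' b').
  by rewrite [evens (interleave a b) 0 m]mxE [evens (interleave a' b') 0 m]mxE.
rewrite -[b in RHS](interleaveKr a b) -[b' in RHS](interleaveKr a' b').
by rewrite [odds (interleave a b) 0 m]mxE [odds (interleave a' b') 0 m]mxE.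
Qed.

Lemma inner_castmx {F : topStarRingType} {m n : nat} (e : m = n)
    (x y : 'rV[F]_m) :
  inner (castmx (erefl 1%N, e) x) (castmx (erefl 1%N, e) y) = inner x y.
Proof. by case: n / e; rewrite !castmx_id. Qed.

(** The real part is additive, and $\overline{(a+bi)}(a'+b'i)$ has real part $aa'+bb'$. *)
Lemma inner_rC {R : realType} {n : nat} (x y : 'rV[R[i]]_n) :
  inner (rC x) (rC y) = complex.Re (inner x y).
Proof.
rewrite inner_interleave /inner -big_split /=.
rewrite (big_morph (@complex.Re R) (id1 := 0) (op1 := +%R)) => [|[? ?] []|] //.
apply: eq_bigr => m _; rewrite !mxE.
by case: (x 0 m) (y 0 m) => a b [a' b'] /=; rewrite /sconj /=; ring.
Qed.

Definition complex_part {R : realType} (q : quaternion R) : R[i] :=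
  (qre q +i* qii q)%C.

(** The order $d+ci$ in the second slot of $c_H$ matters: $\bar q q'$ has $i$-coordinate
    $ab'-ba'+dc'-cd'$, and $\overline{(d+ci)}(d'+c'i)$ supplies $dc'-cd'$, where $c+di$ would give
    the opposite sign. *)
Lemma inner_cH {R : realType} {n : nat} (x y : 'rV[quaternion R]_n) :
  inner (cH x) (cH y) = complex_part (inner x y).
Proof.
rewrite inner_interleave /inner -big_split /=.
rewrite (big_morph complex_part (id1 := 0) (op1 := +%R)) => [|//|//].
apply: eq_bigr => m _; rewrite !mxE.
case: (x 0 m) (y 0 m) => a b c d [a' b' c' d'].
by apply/eqP; rewrite eq_complex /=; apply/andP; split; apply/eqP; ring.
Qed.

Lemma inner_rH {R : realType} {n : nat} (x y : 'rV[quaternion R]_n) :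
  inner (rH x) (rH y) = qre (inner x y).
Proof. by rewrite inner_castmx inner_rC inner_cH. Qed.

(** Each $\bar z z$ is real. Hence the real part of [inner x x] alone decides whether [x] is a unit
    vector, which makes the unit spheres correspond. *)
Lemma Im_inner_self {R : realType} {n : nat} (x : 'rV[R[i]]_n) :
  complex.Im (inner x x) = 0.
Proof.
rewrite /inner.
rewrite (big_morph (@complex.Im R) (id1 := 0) (op1 := +%R)) => [|[? ?] []|] //.
by apply: big1 => m _; case: (x 0 m) => a b /=; ring.
Qed.

(** As over $\mathbb{C}$, each $\bar q q$ is real; this serves the spheres for both $c_H$ and
    $r_H$. *)
Lemma inner_self_quaternion {R : realType} {n : nat} (x : 'rV[quaternion R]_n) :
  inner x x = Quaternion (qre (inner x x)) 0 0 0.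
Proof.
rewrite /inner.
elim/big_rec: _ => [//|m q _ ->].
by case: (x 0 m) => a b c d; congr Quaternion => /=; ring.
Qed.

(** * Continuity of right multiplication by a scalar *)

Lemma mulCr_continuous {R : realType} (t : R[i]) :
  continuous (fun z : R[i] => z * t).
Proof. exact: (@mulrr_continuous R[i] t). Qed.

(** Each coordinate of [q * t] is a linear form in the coordinates of [q]. This needs a proof
    because a [topStarRingType] imposes no link between topology and product. *)
Lemma mulqr_continuous {R : realType} (t : quaternion R) :
  continuous (fun q : quaternion R => q * t).
Proof.
case: t => a b c d.
have -> : (fun q => q * Quaternion a b c d) = (fun q => Quaternion
    (qre q * a - qii q * b - qjj q * c - qkk q * d)
    (qre q * b + qii q * a + qjj q * d - qkk q * c)
    (qre q * c - qii q * d + qjj q * a + qkk q * b)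
    (qre q * d + qii q * c - qjj q * b + qkk q * a)).
  by apply/funext => -[].
have cB (f g : quaternion R -> R) :
    continuous f -> continuous g -> continuous (fun q => f q - g q).
  by move=> fc gc q; exact: cvgB (fc q) (gc q).
have cD (f g : quaternion R -> R) :
    continuous f -> continuous g -> continuous (fun q => f q + g q).
  by move=> fc gc q; exact: cvgD (fc q) (gc q).
have cM (f : quaternion R -> R) r :
    continuous f -> continuous (fun q => f q * r).
  by move=> fc q; exact: cvgMr_tmp (fc q).
have re := cM _ _ qre_continuous; have ii := cM _ _ qii_continuous.
have jj := cM _ _ qjj_continuous; have kk := cM _ _ qkk_continuous.
apply: continuous_quaternion.
- exact: (cB _ _ (cB _ _ (cB _ _ (re _) (ii _)) (jj _)) (kk _)).
- exact: (cB _ _ (cD _ _ (cD _ _ (re _) (ii _)) (jj _)) (kk _)).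
- exact: (cD _ _ (cD _ _ (cB _ _ (re _) (ii _)) (jj _)) (kk _)).
- exact: (cD _ _ (cB _ _ (cD _ _ (re _) (ii _)) (jj _)) (kk _)).
Qed.

(** * Transfer of vector fields along a homeomorphism *)

Lemma within_continuous_sandwich {S T U V : topologicalType} {A : set S}
    {B : set T} {g : S -> T} {v : T -> U} {f : U -> V} :
  continuous g -> (forall x, A x -> B (g x)) -> {within B, continuous v} ->
  continuous f -> {within A, continuous (f \o v \o g)}.
Proof.
move=> gc AB /subspace_continuousP vc fc; apply/subspace_continuousP => x Ax.
(* Since [g] maps [A] into [B], it also converges along the relative neighbourhood filters, the only
   ones for which continuity of [v] is known. *)
have gAB : g @ within A (nbhs x) --> within B (nbhs (g x)).
  move=> P BP; suff : \forall y \near x, A y -> P (g y) by [].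
  have gBP : \forall y \near x, B (g y) -> P (g y) by exact: (gc _ _ BP).
  by apply: filterS gBP => y BPy Ay; exact/BPy/AB.
have fv : (f \o v) @ within B (nbhs (g x)) --> f (v (g x)).
  by apply: cvg_comp; [exact: vc (AB _ Ax)|exact: fc].
by apply: cvg_comp; [exact: gAB|exact: fv].
Qed.

(* [s] is a right inverse of [t]: it keeps [alpha t] from killing [v]. *)
Lemma vector_field_transfer {F G : topStarRingType} {n m : nat} {pr : F -> G}
    {f : 'rV[F]_n -> 'rV[G]_m} {g : 'rV[G]_m -> 'rV[F]_n} {t s : F}
    {v : 'rV[F]_n -> 'rV[F]_n} :
  cancel f g -> cancel g f -> continuous f -> continuous g -> g 0 = 0 ->
  (forall x y, inner (f x) (f y) = pr (inner x y)) ->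
  (forall x : 'rV[F]_n, pr (inner x x) = 1 <-> inner x x = 1) ->
  continuous (fun q : F => q * t) -> t * s = 1 -> continuous_nonzero v ->
  vector_field (f \o alpha t \o v \o g) <->
  forall x, usphere x -> pr (inner x (v x) * t) = 0.
Proof.
move=> fK gK fc gc g0 fE prE tc ts [vc v0].
have Sg y : usphere y -> usphere (g y).
  by rewrite /usphere /= => y1; apply/prE; rewrite -fE gK.
have Sf x : usphere x -> usphere (f x).
  by rewrite /usphere /= => x1; rewrite fE; apply/prE.
have at_c : continuous (alpha t : 'rV[F]_n -> 'rV[F]_n).
  exact: row_map_continuous tc.
split=> [[_ h] x Sx|h].
  by have := h _ (Sf _ Sx); rewrite /= fE fK inner_alpha.
split; last first.
  (* Only the position vector [y] is rewritten as [f (g y)], so that [fE] applies to both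
     arguments. *)
  by move=> y Sy; rewrite /= -{1}[y]gK fE inner_alpha; exact/h/Sg.
split.
  have fac := continuousT_comp at_c fc.
  exact: (within_continuous_sandwich gc Sg vc fac).
(* Applying [g], which sends 0 to 0, gives [alpha t (v (g y)) = 0]; cancelling [t] by [s]
   contradicts [v0]. *)
move=> y Sy; apply/eqP => /= fy0.
have /eqP[] := v0 _ (Sg _ Sy); apply: (alpha_eq0 _ _ _ ts).
by rewrite -[LHS]fK fy0.
Qed.

(** The case [t = s = 1], where [alpha 1] is the identity. *)
Lemma vector_field_transfer1 {F G : topStarRingType} {n m : nat} {pr : F -> G}
    {f : 'rV[F]_n -> 'rV[G]_m} {g : 'rV[G]_m -> 'rV[F]_n}
    {v : 'rV[F]_n -> 'rV[F]_n} :
  cancel f g -> cancel g f -> continuous f -> continuous g -> g 0 = 0 ->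
  (forall x y, inner (f x) (f y) = pr (inner x y)) ->
  (forall x : 'rV[F]_n, pr (inner x x) = 1 <-> inner x x = 1) ->
  continuous_nonzero v ->
  vector_field (f \o v \o g) <->
  forall x, usphere x -> pr (inner x (v x)) = 0.
Proof.
move=> fK gK fc gc g0 fE prE vc.
have id_c : continuous (fun q : F => q * 1).
  by under eq_fun do rewrite mulr1.
have := vector_field_transfer fK gK fc gc g0 fE prE id_c (mulr1 1) vc.
have -> : f \o alpha 1 \o v \o g = f \o v \o g.
  by apply/funext => y; rewrite /= alpha1.
by under [X in _ <-> X -> _]eq_forall do rewrite mulr1.
Qed.

Theorem theorem2p3 (R : realType) (n : nat)
    (v : 'rV[R[i]]_n -> 'rV[R[i]]_n)
    (w : 'rV[quaternion R]_n -> 'rV[quaternion R]_n) :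
  (0 < n)%N -> continuous_nonzero v -> continuous_nonzero w ->
  [/\ vector_field v <->
        vector_field (rC \o v \o rC_inv) /\
        vector_field (rC \o alpha 'i%C \o v \o rC_inv),
      vector_field w <->
        vector_field (cH \o w \o cH_inv) /\
        vector_field (cH \o alpha quat_j \o w \o cH_inv)
    & vector_field w <->
        vector_field (rH \o w \o rH_inv) /\
        forall t, t \in [:: quat_i; quat_j; quat_k] ->
          vector_field (rH \o alpha t \o w \o rH_inv)].
Proof.
move=> _ vc wc.
have rC0 : rC_inv 0 = 0 :> 'rV[R[i]]_n by apply/rowP => m; rewrite !mxE.
have cH0 : cH_inv 0 = 0 :> 'rV[quaternion R]_n by apply/rowP => m; rewrite !mxE.
have rH0 : rH_inv 0 = 0 :> 'rV[quaternion R]_n.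
  rewrite /rH_inv castmx_const -[RHS]cH0; congr cH_inv.
  by apply/rowP => m; rewrite !mxE.
have rCn (x : 'rV[R[i]]_n) : complex.Re (inner x x) = 1 <-> inner x x = 1.
  split=> [|->//]; have := Im_inner_self x.
  by case: (inner x x) => a b /= -> ->.
have cHn (x : 'rV[quaternion R]_n) :
    complex_part (inner x x) = 1 <-> inner x x = 1.
  by split=> [|->//]; rewrite inner_self_quaternion => -[->].
have rHn (x : 'rV[quaternion R]_n) : qre (inner x x) = 1 <-> inner x x = 1.
  by split=> [|->//]; rewrite {2}inner_self_quaternion => ->.
(* Each imaginary unit $u$ satisfies $u^2=-1$, so $-u$ is the right inverse that the transfer asks
   for. *)
have uC : 'i%C * - 'i%C = 1 :> R[i] by rewrite mulrN -expr2 sqr_i opprK.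
have ui : quat_i * - quat_i = 1 :> quaternion R by congr Quaternion => /=; ring.
have uj : quat_j * - quat_j = 1 :> quaternion R by congr Quaternion => /=; ring.
have uk : quat_k * - quat_k = 1 :> quaternion R by congr Quaternion => /=; ring.
have trC t s := @vector_field_transfer _ _ _ _ _ _ _ t s _
  (@rCK R n) (@rC_invK R n) rC_continuous rC_inv_continuous rC0 inner_rC rCn
  (mulCr_continuous t).
have trC1 := vector_field_transfer1 (@rCK R n) (@rC_invK R n)
  rC_continuous rC_inv_continuous rC0 inner_rC rCn vc.
have tcH t s := @vector_field_transfer _ _ _ _ _ _ _ t s _
  (@cHK R n) (@cH_invK R n) cH_continuous cH_inv_continuous cH0 inner_cH cHn
  (mulqr_continuous t).
have tcH1 := vector_field_transfer1 (@cHK R n) (@cH_invK R n)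
  cH_continuous cH_inv_continuous cH0 inner_cH cHn wc.
have trH t s := @vector_field_transfer _ _ _ _ _ _ _ t s _
  (@rHK R n) (@rH_invK R n) rH_continuous rH_inv_continuous rH0 inner_rH rHn
  (mulqr_continuous t).
have trH1 := vector_field_transfer1 (@rHK R n) (@rH_invK R n)
  rH_continuous rH_inv_continuous rH0 inner_rH rHn wc.
split.
- split=> [[_ v0]|[/trC1 h1 /(trC _ _ _ uC vc) hi]].
    split; [apply/trC1|apply/(trC _ _ _ uC vc)] => x /v0 -> //.
    by rewrite mul0r.
  split=> // x Sx; move: (h1 x Sx) (hi x Sx).
  (* For $\langle x|v(x)\rangle=a+bi$, [h1] says $a=0$, and [hi] says $-b=0$, the real part of
     $(a+bi)i$. *)
  case: (inner x (v x)) => a b /= -> /eqP.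
  by rewrite mul0r mulr1 sub0r oppr_eq0 => /eqP->.
- split=> [[_ w0]|[/tcH1 h1 /(tcH _ _ _ uj wc) hj]].
    split; [apply/tcH1|apply/(tcH _ _ _ uj wc)] => x /w0 -> //.
    by rewrite mul0r.
  split=> // x Sx; move: (h1 x Sx) (hj x Sx).
  (* [h1] kills $a$ and $b$. Right multiplication by $j$ moves the other two coordinates into the
     complex part, which becomes $-c-di$. *)
  case: (inner x (w x)) => a b c d [-> ->] [].
  rewrite !(mul0r, mulr0, mulr1, sub0r, subr0, addr0, oppr0).
  by do 2![move=> /eqP; rewrite oppr_eq0 => /eqP->].
- split=> [[_ w0]|[/trH1 h1 ht]].
    split=> [|t]; first by apply/trH1 => x /w0 ->.
    by rewrite !inE => /or3P[]/eqP->;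
      [apply/(trH _ _ _ ui wc)|apply/(trH _ _ _ uj wc)
      |apply/(trH _ _ _ uk wc)] => x /w0 ->; rewrite mul0r.
  have /(trH _ _ _ ui wc) hi := ht quat_i (mem_head _ _).
  have j_in : quat_j \in [:: @quat_i R; quat_j; quat_k].
    by rewrite !inE eqxx orbT.
  have /(trH _ _ _ uj wc) hj := ht _ j_in.
  have k_in : quat_k \in [:: @quat_i R; quat_j; quat_k].
    by rewrite !inE eqxx !orbT.
  have /(trH _ _ _ uk wc) hk := ht _ k_in.
  split=> // x Sx; move: (h1 x Sx) (hi x Sx) (hj x Sx) (hk x Sx).
  (* [h1] kills $a$; the real parts of $qi$, $qj$, $qk$ for $q=a+bi+cj+dk$ are $-b$, $-c$, $-d$. *)
  case: (inner x (w x)) => a b c d /= ->.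
  rewrite !(mul0r, mulr0, mulr1, addr0, sub0r, subr0, oppr0).
  by do 3![move=> /eqP; rewrite oppr_eq0 => /eqP->].
Qed.
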